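(* For any integers $m\ge 4$ and $0\le t\le m-1$, \[ r\bigl(C_4,B_{(m-1)^2+(t-2)}\bigr)\le m^2+t. \]
   Context: For graphs $H_1,H_2$, the Ramsey number $r(H_1,H_2)$ is the smallest integer $N$ such that for every graph $G$ on $N$ vertices, either $G$ contains $H_1$ as a subgraph or the complement $\overline{G}$ contains $H_2$ as a subgraph. $C_4$ denotes the cycle of length 4. For $n\ge 1$, the book $B_n$ is the graph consisting of $n$ triangles sharing a common edge (i.e. $K_2$ joined to an independent set of $n$ vertices). *)

(* Defs.v *)
From HB Require Import structures.
From mathcomp Require Import all_boot.
From mathcomp Require Import boolp.

Set Implicit Arguments.
Unset Strict Implicit.
Unset Printing Implicit Defensive.

Record sgraph := SGraph {
  vertex :> finType;
  adj : rel vertex;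
  adj_sym : symmetric adj;
  adj_irrefl : irreflexive adj }.

Definition compl_adj (G : sgraph) : rel G := [rel x y | (x != y) && ~~ adj x y].

Lemma compl_adj_sym (G : sgraph) : symmetric (@compl_adj G).
Proof. by move=> x y; rewrite /compl_adj /= eq_sym adj_sym. Qed.

Lemma compl_adj_irrefl (G : sgraph) : irreflexive (@compl_adj G).
Proof. by move=> x; rewrite /compl_adj /= eqxx. Qed.

Definition compl (G : sgraph) : sgraph :=
  SGraph (@compl_adj_sym G) (@compl_adj_irrefl G).

(* Subgraph containment is up to isomorphism and not necessarily induced. *)
Definition contains (G H : sgraph) : Prop :=
  exists f : H -> G,
    injective f /\ forall x y : H, adj x y -> adj (f x) (f y).

Definition C4_adj : rel 'I_4 :=
  [rel i j : 'I_4 | (i + 1 == j %[mod 4]) || (j + 1 == i %[mod 4])].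

Lemma C4_adj_sym : symmetric C4_adj.
Proof. by move=> i j; rewrite /C4_adj /= orbC. Qed.

Lemma C4_adj_irrefl : irreflexive C4_adj.
Proof. by case=> [[|[|[|[|i]]]] Hi]. Qed.

Definition C4 : sgraph := SGraph C4_adj_sym C4_adj_irrefl.

(* [bool] carries the common edge, ['I_n] the n remaining vertices. *)
Definition book_adj (n : nat) : rel (bool + 'I_n) :=
  fun x y => match x, y with
             | inl a, inl b => a != b
             | inl _, inr _ | inr _, inl _ => true
             | inr _, inr _ => false
             end.

Lemma book_adj_sym n : symmetric (@book_adj n).
Proof. by move=> [a|i] [b|j] //=; rewrite eq_sym. Qed.

Lemma book_adj_irrefl n : irreflexive (@book_adj n).
Proof. by move=> [a|i] //=; rewrite eqxx. Qed.

Definition book (n : nat) : sgraph :=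
  SGraph (@book_adj_sym n) (@book_adj_irrefl n).

Definition arrows (H1 H2 : sgraph) (N : nat) : Prop :=
  forall G : sgraph, #|G| = N -> contains G H1 \/ contains (compl G) H2.

Definition homogeneous (T : finType) (e : rel T) (K : {set T}) : Prop :=
  {in K &, forall x y, x != y -> e x y}.

Lemma homogeneous_add (T : finType) (e : rel T) (A K : {set T}) (x : T) :
  symmetric e -> irreflexive e -> K \subset [set y in A | e x y] ->
  homogeneous e K -> homogeneous e (x |: K) /\ #|x |: K| = #|K|.+1.
Proof.
move=> es ei /subsetP sK hK.
have eK y : y \in K -> e x y by move=> /sK; rewrite inE => /andP[].
split; last first.
  by rewrite cardsU1; case: (boolP (x \in K)) => // /eK; rewrite ei.
move=> y z; rewrite !inE => /orP[/eqP->|yK] /orP[/eqP->|zK] ne.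
- by rewrite eqxx in ne.
- exact: eK.
- by rewrite es; exact: eK.
- exact: hK.
Qed.

Lemma ramsey_sets (k l : nat) : exists N, forall (G : sgraph) (A : {set G}),
  N <= #|A| ->
  (exists K : {set G}, [/\ K \subset A, homogeneous (@adj G) K & #|K| = k]) \/
  (exists K : {set G}, [/\ K \subset A, homogeneous (@compl_adj G) K & #|K| = l]).
Proof.
elim: k l => [|k IHk] l.
  exists 0 => G A _; left; exists set0; rewrite sub0set cards0; split=> //.
  by move=> x y; rewrite inE.
elim: l => [|l [N2 IHl]].
  exists 0 => G A _; right; exists set0; rewrite sub0set cards0; split=> //.
  by move=> x y; rewrite inE.
have [N1 IH1] := IHk l.+1.
exists (N1 + N2).+1 => G A leA.
have [x xA] : exists x, x \in A by apply/card_gt0P; exact: leq_trans leA.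
pose B := [set y in A | adj x y]; pose C := [set y in A | compl_adj x y].
have sBA : B \subset A by apply/subsetP=> y; rewrite inE => /andP[].
have sCA : C \subset A by apply/subsetP=> y; rewrite inE => /andP[].
have cov : A \subset x |: (B :|: C).
  apply/subsetP=> y yA; rewrite !inE yA /compl_adj /= (eq_sym x y).
  by case: (y == x) => //=; case: (adj x y).
have leBC : N1 + N2 <= #|B| + #|C|.
  have := leq_trans leA (subset_leq_card cov); rewrite cardsU1 => h.
  have {}h : (N1 + N2).+1 <= 1 + #|B :|: C|.
    by apply: leq_trans h _; rewrite leq_add2r leq_b1.
  by rewrite add1n ltnS in h; apply: leq_trans h _; rewrite cardsU leq_subr.
have [le1|lt1] := leqP N1 #|B|.
  have [[K [sK hK cK]]|[K [sK hK cK]]] := IH1 G B le1.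
  - left; exists (x |: K); have [h c] := homogeneous_add (@adj_sym G) (@adj_irrefl G) sK hK.
    by rewrite subUset sub1set xA (subset_trans sK sBA) c cK.
  - by right; exists K; rewrite (subset_trans sK sBA).
have le2 : N2 <= #|C|.
  by rewrite -(leq_add2l N1); apply: leq_trans leBC _; rewrite leq_add2r ltnW.
have [[K [sK hK cK]]|[K [sK hK cK]]] := IHl G C le2.
- by left; exists K; rewrite (subset_trans sK sCA).
- right; exists (x |: K).
  have [h c] := homogeneous_add (@compl_adj_sym G) (@compl_adj_irrefl G) sK hK.
  by rewrite subUset sub1set xA (subset_trans sK sCA) c cK.
Qed.

Lemma homogeneous_contains (G H : sgraph) (K : {set G}) :
  homogeneous (@adj G) K -> #|K| = #|H| -> contains G H.
Proof.
move=> hK cK.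
pose f (x : H) : G := enum_val (cast_ord (esym cK) (enum_rank x)).
have fi : injective f by move=> x y /enum_val_inj/cast_ord_inj/enum_rank_inj.
exists f; split=> // x y exy; apply: hK; rewrite ?enum_valP // (inj_eq fi).
by apply: contraTneq exy => ->; rewrite adj_irrefl.
Qed.

Theorem arrows_exists (H1 H2 : sgraph) : exists N, arrows H1 H2 N.
Proof.
have [N hN] := ramsey_sets #|H1| #|H2|; exists N => G cG.
have [|[K [_ hK cK]]|[K [_ hK cK]]] := hN G setT; rewrite ?cardsT ?cG //.
- by left; apply: homogeneous_contains cK.
- by right; apply: (@homogeneous_contains (compl G) H2 K).
Qed.

Lemma arrows_existsb (H1 H2 : sgraph) : exists N, `[< arrows H1 H2 N >].
Proof. by have [N hN] := arrows_exists H1 H2; exists N; apply/asboolP. Qed.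

Definition ramsey (H1 H2 : sgraph) : nat := ex_minn (arrows_existsb H1 H2).

Lemma ramsey_arrows (H1 H2 : sgraph) : arrows H1 H2 (ramsey H1 H2).
Proof. by rewrite /ramsey; case: ex_minnP => N /asboolP. Qed.

Lemma ramsey_min (H1 H2 : sgraph) (N : nat) :
  arrows H1 H2 N -> ramsey H1 H2 <= N.
Proof. by move=> h; rewrite /ramsey; case: ex_minnP => M _; apply; apply/asboolP. Qed.

(* Main.v *)
(** Let [G] be a C4-free graph on [N = m^2 + t] vertices whose complement has no
book of the given size.  Counting common non-neighbours, nonadjacent vertices
[u], [v] satisfy [d(u) + d(v) >= 2m + c(u, v)], with [c] the codegree.  Let [A]
be the set of vertices of degree at most [m].  Two vertices of [A] with a common
neighbour are adjacent, so, as [K4] contains [C4], every vertex has at most two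
neighbours in [A].  Since [G] is C4-free, the sets [N(w) \ {x}], for [w] a
neighbour of [x], are disjoint, so the [d(w) - 1] add up to at most
[N - 1 <= m^2 + m - 2]; hence a vertex outside [A] has a neighbour in [A].
If some [v] has degree less than [m], it is adjacent to the rest of [A]; thus
[#|A| <= 3] and [A] dominates at most [3 (m + 1) < m^2] vertices.  Otherwise a
vertex outside [A] has two neighbours in [A] by the same count, and two
neighbours outside [A] of a vertex of [A] give a [C4]. *)
Require Import Defs.
From mathcomp Require Import all_boot.
From mathcomp Require Import boolp zify.

Set Implicit Arguments.
Unset Strict Implicit.
Unset Printing Implicit Defensive.

Definition nbh (G : sgraph) (x : G) : {set G} := [set y | adj x y].

Lemma in_nbh (G : sgraph) (x y : G) : (y \in nbh x) = adj x y.
Proof. by rewrite inE. Qed.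

Lemma adj_neq (G : sgraph) (x y : G) : adj x y -> x != y.
Proof. by apply: contraTneq => ->; rewrite adj_irrefl. Qed.

Lemma contains_C4 (G : sgraph) (a b c d : G) :
  adj a b -> adj b c -> adj c d -> adj d a -> a != c -> b != d ->
  contains G C4.
Proof.
move=> ab bc cd da ac bd.
have us : uniq [:: a; b; c; d].
  rewrite /= !inE !negb_or ac bd (eq_sym a d).
  by rewrite !(adj_neq ab, adj_neq bc, adj_neq cd, adj_neq da).
exists (fun i : 'I_4 => nth a [:: a; b; c; d] i); split=> [i j /eqP|].
  by rewrite nth_uniq // => /eqP/val_inj.
by move=> [[|[|[|[|i]]]] //= ?] [[|[|[|[|j]]]] //= ?] _; rewrite // adj_sym.
Qed.

Lemma contains_compl_book (G : sgraph) (n : nat) (u v : G) (W : {set G}) :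
  u != v -> ~~ adj u v -> n <= #|W| ->
  (forall w, w \in W -> compl_adj u w && compl_adj v w) ->
  contains (compl G) (book n).
Proof.
move=> uv nuv leW hW.
have cuv : compl_adj u v by rewrite /compl_adj /= uv.
pose g (i : 'I_n) : G := enum_val (widen_ord leW i).
have gi : injective g by move=> i j /enum_val_inj/(congr1 val)/= /val_inj.
have gW i : compl_adj u (g i) && compl_adj v (g i) by apply/hW/enum_valP.
pose h (b : bool) : G := if b then u else v.
have hg b i : compl_adj (h b) (g i) by have /andP[? ?] := gW i; case: b.
pose f (x : book n) : G := match x with inl b => h b | inr i => g i end.
have hne b i : h b != g i by have /andP[] := hg b i.
exists f; split.
- move=> [b|i] [c|j] /=.
  + by case: b c => [] [] //= e; move: uv; rewrite e eqxx.
  + by move/eqP; rewrite (negPf (hne _ _)).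
  + by move/eqP; rewrite eq_sym (negPf (hne _ _)).
  + by move/gi->.
- move=> [b|i] [c|j] //=.
  + by case: b c => [] [] //= _; rewrite 1?(compl_adj_sym v).
  + by move=> _; rewrite compl_adj_sym.
Qed.

(** The vertices outside [nbh u], [nbh v] and [[set u; v]] are pages over the spine [u], [v] in the
    complement, so there are fewer than [n] of them. *)
Lemma bookfree_deg (G : sgraph) (n : nat) (u v : G) :
  ~ contains (compl G) (book n) -> u != v -> ~~ adj u v ->
  #|G| + #|nbh u :&: nbh v| < n + 2 + #|nbh u| + #|nbh v|.
Proof.
move=> nB uv nuv.
pose W := ~: (nbh u :|: nbh v :|: [set u; v]).
have ltW : #|W| < n.
  rewrite ltnNge; apply/negP=> leW; apply: nB.
  apply: (contains_compl_book uv nuv leW) => w.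
  by rewrite /compl_adj !inE !negb_or /= !(eq_sym w) -andbA => /and4P[-> -> -> ->].
have leU := leq_card_setU (nbh u :|: nbh v) [set u; v].
have := cardsC (nbh u :|: nbh v :|: [set u; v]).
have := cardsUI (nbh u) (nbh v).
rewrite -/W; move: (leU.1); rewrite cards2 uv.
by lia.
Qed.

Section C4Free.

Variable G : sgraph.
Hypothesis noC4 : ~ contains G C4.

Lemma C4free_codeg (x y : G) : x != y -> #|nbh x :&: nbh y| <= 1.
Proof.
move=> xy; apply/card_le1_eqP=> a b.
rewrite !inE => /andP[xa ya] /andP[xb yb]; apply/eqP/negPn/negP => ab.
by apply: noC4; apply: (@contains_C4 G x a y b);
  rewrite // 1?eq_sym // adj_sym.
Qed.

Lemma C4free_sum_deg (x : G) : \sum_(w in nbh x) (#|nbh w| - 1) <= #|G| - 1.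
Proof.
have -> : \sum_(w in nbh x) (#|nbh w| - 1) =
          \sum_(w in nbh x) \sum_(u | u != x) (adj w u : nat).
  apply: eq_bigr => w; rewrite in_nbh adj_sym => wx.
  rewrite -sum1_card (bigD1 x) ?in_nbh //= addKn -big_mkcondr /=.
  by apply: eq_bigl => u; rewrite in_nbh andbC.
(* Double counting: for fixed [u], the inner sum becomes the codegree of [x] and [u], hence at most
   1. *)
rewrite exchange_big /=.
have -> : #|G| - 1 = \sum_(u | u != x) 1 by rewrite sum1_card cardC1 subn1.
apply: leq_sum => u ux; rewrite eq_sym in ux.
rewrite -big_mkcondr /= sum1_card; apply: leq_trans (C4free_codeg ux).
apply: subset_leq_card; apply/subsetP => w /andP[xw wu].
by rewrite in_setI xw in_nbh adj_sym.
Qed.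

Variable m : nat.
Hypothesis m_ge4 : 4 <= m.
Hypothesis card_ge : m ^ 2 <= #|G|.
Hypothesis card_lt : #|G| < m ^ 2 + m.
Hypothesis nonadj_deg : forall u v : G, u != v -> ~~ adj u v ->
  2 * m + #|nbh u :&: nbh v| <= #|nbh u| + #|nbh v|.

Let A : {set G} := [set x | #|nbh x| <= m].

Lemma sum_deg_le (x : G) :
  \sum_(w in nbh x) (#|nbh w| - 1) <= m ^ 2 + m - 2.
Proof.
have leG : #|G| <= m ^ 2 + m - 1 by move: card_lt; lia.
by apply: leq_trans (leq_trans (C4free_sum_deg x) (leq_sub2r 1 leG)) _; lia.
Qed.

Lemma small_deg_adj (x a b : G) : a \in A -> b \in A -> a != b ->
  adj x a -> adj x b -> adj a b.
Proof.
rewrite !inE => aA bA ab xa xb; apply/negPn/negP => nab.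
have := nonadj_deg ab nab.
have : 0 < #|nbh a :&: nbh b|.
  by apply/card_gt0P; exists x; rewrite !inE !(adj_sym _ x) xa.
by lia.
Qed.

Lemma card_small_nbh (x : G) : #|nbh x :&: A| <= 2.
Proof.
rewrite leqNgt; apply/negP => /card_gt2P[a [b [c [[]]]]].
rewrite !in_setI !in_nbh => /andP[xa aA] /andP[xb bA] /andP[xc cA] [ab bc ca].
apply: noC4; apply: (@contains_C4 G x a b c) => //.
- exact: small_deg_adj xa xb.
- exact: small_deg_adj xb xc.
- by rewrite adj_sym.
- exact: adj_neq.
- by rewrite eq_sym.
Qed.

Lemma large_deg_dominated (x : G) : x \notin A -> exists2 a, a \in A & adj a x.
Proof.
rewrite inE -ltnNge => dx.
have [[a]|nA] := pselect (exists a, a \in nbh x :&: A).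
  by rewrite in_setI in_nbh adj_sym => /andP[ax aA]; exists a.
have := sum_deg_le x.
(* With no neighbour of [x] in [A], every summand is at least [m]; as [x] has more than [m]
   neighbours, the sum reaches [m * (m + 1)]. *)
have : \sum_(w in nbh x) m <= \sum_(w in nbh x) (#|nbh w| - 1).
  apply: leq_sum => w wx; rewrite leqNgt; apply/negP => h.
  by apply: nA; exists w; rewrite in_setI wx inE; lia.
by rewrite sum_nat_const; nia.
Qed.

Lemma min_deg (v : G) : m <= #|nbh v|.
Proof.
rewrite leqNgt; apply/negP => dv.
(* A vertex other than [v] and not adjacent to it has degree at least [2 * m - #|nbh v|], which
   exceeds [m]. *)
have sA : A \subset v |: (nbh v :&: A).
  apply/subsetP => a aA; rewrite in_setU1 in_setI aA in_nbh andbT eq_sym.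
  have [//|va /=] := eqVneq v a; apply/negPn/negP => nva.
  by have := nonadj_deg va nva; move: aA; rewrite inE; lia.
have A3 : #|A| <= 3.
  apply: leq_trans (subset_leq_card sA) _; rewrite cardsU1.
  by have := card_small_nbh v; case: (_ \notin _); lia.
have cov : [set: G] \subset A :|: \bigcup_(a in A) nbh a.
  apply/subsetP => x _; rewrite in_setU.
  have [//|/large_deg_dominated[a aA ax] /=] := boolP (x \in A).
  by apply/bigcupP; exists a; rewrite ?in_nbh.
have := subset_leq_card cov; rewrite cardsT => leG.
have := (leq_card_setU A (\bigcup_(a in A) nbh a)).1.
have : #|\bigcup_(a in A) nbh a| <= #|A| * m.
  rewrite -sum_nat_const.
  apply: (big_rec2 (fun (S : {set G}) k => #|S| <= k)); first by rewrite cards0.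
  move=> a k S; rewrite inE => da leS.
  by apply: leq_trans (leq_card_setU _ _).1 (leq_add da leS).
(* The bounds give [m ^ 2 <= 3 + 3 * m], which fails from [m = 4] on. *)
by nia.
Qed.

Lemma large_deg_two_small_nbh (x : G) : x \notin A -> 1 < #|nbh x :&: A|.
Proof.
rewrite inE -ltnNge => dx.
have := sum_deg_le x.
(* By [min_deg], a summand falls short of [m] by at most 1, and only for [w] in [A]; the total falls
   short of [m * (m + 1)] by at least 2. *)
have : \sum_(w in nbh x) m <=
       \sum_(w in nbh x) ((#|nbh w| - 1) + (w \in A : nat)).
  by apply: leq_sum => w _; rewrite inE; have := min_deg w; lia.
rewrite sum_nat_const big_split /= -big_mkcondr /= sum1_card.
have -> : #|[pred i | (i \in nbh x) && (i \in A)]| = #|nbh x :&: A|.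
  by apply: eq_card => w; rewrite in_setI.
by have := leq_mul dx (leqnn m); nia.
Qed.

Lemma large_deg_second_small_nbh (a x : G) : a \in A -> x \notin A -> adj a x ->
  exists b, [/\ b \in A, adj a b & adj x b].
Proof.
move=> aA xA ax; have := large_deg_two_small_nbh xA.
rewrite (cardsD1 a) in_setI in_nbh adj_sym ax aA ltnS => /card_gt0P[b].
rewrite !in_setD1 in_setI in_nbh => /and3P[ba xb bA]; exists b; split=> //.
by apply: (@small_deg_adj x); rewrite // 1?eq_sym // adj_sym.
Qed.

Lemma C4free_nonadj_deg_false : False.
Proof.
have [a aA] : exists a, a \in A.
  have /card_gt0P[x _] : 0 < #|G| by nia.
  have [|/large_deg_dominated[a]] := boolP (x \in A); first by exists x.
  by exists a.
(* At least [m >= 4] neighbours, at most two of them in [A]. *)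
have /card_gt1P[x [y [xD yD xy]]] : 1 < #|nbh a :\: A|.
  by have := cardsID A (nbh a); have := card_small_nbh a; have := min_deg a; lia.
move: xD yD; rewrite !in_setD !in_nbh => /andP[xA ax] /andP[yA ay].
have [b [bA ab xb]] := large_deg_second_small_nbh aA xA ax.
have [c [cA ac yc]] := large_deg_second_small_nbh aA yA ay.
(* If [b = c], the cycle is [a x b y]. Otherwise [b] and [c] are adjacent through their common
   neighbour [a], and the cycle is [a x b c]. *)
apply: noC4; have [bc|bc] := eqVneq b c.
  apply: (@contains_C4 G a x b y) => //; try exact: adj_neq.
  - by rewrite bc adj_sym.
  - by rewrite adj_sym.
apply: (@contains_C4 G a x b c) => //; try exact: adj_neq.
- by apply: (@small_deg_adj a).
- by rewrite adj_sym.
- by apply: contraNneq xA => ->.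
Qed.

End C4Free.

Theorem theorem1 (m t : nat) (hm : 4 <= m) (ht : t <= m - 1) :
  ramsey C4 (book ((m - 1) ^ 2 + t - 2)) <= m ^ 2 + t.
Proof.
apply: ramsey_min => G cG.
have [|noC4] := pselect (contains G C4); first by left.
have [|noB] := pselect (contains (compl G) (book ((m - 1) ^ 2 + t - 2))).
  by right.
exfalso; apply: (@C4free_nonadj_deg_false G noC4 m) => //; rewrite ?cG; try lia.
(* Here [m ^ 2 - (m - 1) ^ 2 = 2 * m - 1], and strictness supplies the missing 1; as
   [(m - 1) ^ 2 >= 9], subtracting 2 does not truncate. *)
move=> u v uv nuv; have := bookfree_deg noB uv nuv; rewrite cG.
by nia.
Qed.
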